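(* The Positivity Problem for linear recurrence sequences over $\mathbb{Q}$ can be (algorithmically) reduced to the energy satisfaction problem restricted to instances in which $(M,q)$ is a Markov chain and the weight function $w$ is linear.
   Context: A sequence $(u_n)_{n\in\mathbb{N}}$ is a linear recurrence sequence over $\mathbb{Q}$ if there are $d\ge1$ and $a_0,\ldots,a_{d-1}\in\mathbb{Q}$ with $u_{n+d}=\sum_{i=0}^{d-1}a_iu_{n+i}$ for all $n$, and $u_n\in\mathbb{Q}$ for all $n$; it is given by the $a_i$ and its initial terms $u_0,\ldots,u_{d-1}$. The Positivity Problem is: given a linear recurrence sequence $(u_n)_{n\in\mathbb{N}}$ over $\mathbb{Q}$, decide whether $u_n\ge0$ for all $n$. The energy satisfaction problem is: given $M\in\mathbb{Q}^{d\times d}$, $q\in\mathbb{Q}^d$, $B\in\mathbb{Q}$ and a polynomial weight function $w$ in $d$ variables with rational coefficients, decide whether there exists $n$ such that $\sum_{k=0}^nw(M^kq)<B$. $(M,q)$ is a Markov chain if $M$ and $q$ have non-negative entries, each column of $M$ sums to $1$, and the entries of $q$ sum to $1$. *)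

(* Defs.v *)
From HB Require Import structures.
From mathcomp Require Import all_boot all_order all_algebra.
From mathcomp Require Import mpoly.

Set Implicit Arguments.
Unset Strict Implicit.
Unset Printing Implicit Defensive.

Import Order.TTheory GRing.Theory Num.Theory.
Local Open Scope ring_scope.

(* Kleene's partial recursive functions relative to an oracle.  Arities are
   not tracked: a program acts on an argument list of any length, and [Proj]
   returns 0 beyond its end. *)
Inductive prog : Type :=
| Zero
| Succ
| Proj of nat
| Comp of prog & seq prog
| Rec of prog & prog
| Mu of prog
| Query.

(* [eval O p s y]: with oracle [O], the program [p] halts on [s] with value
   [y].  The oracle is a relation: a query [c] such that no [y] satisfies
   [O c y] receives no answer, and the computation does not halt. *)
Inductive eval (O : nat -> nat -> Prop) : prog -> seq nat -> nat -> Prop :=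
| eval_Zero s : eval O Zero s 0%N
| eval_Succ x s : eval O Succ (x :: s) x.+1
| eval_Proj i s : eval O (Proj i) s (nth 0%N s i)
| eval_Comp f gs s ys y :
    evals O gs s ys -> eval O f ys y -> eval O (Comp f gs) s y
| eval_Rec0 f g s y : eval O f s y -> eval O (Rec f g) (0%N :: s) y
| eval_RecS f g n s r y :
    eval O (Rec f g) (n :: s) r -> eval O g [:: n, r & s] y ->
    eval O (Rec f g) (n.+1 :: s) y
| eval_Mu f s n (v : nat -> nat) :
    (forall m, (m < n)%N -> eval O f (m :: s) (v m).+1) ->
    eval O f (n :: s) 0%N -> eval O (Mu f) s n
| eval_Query c s y : O c y -> eval O Query (c :: s) y
with evals (O : nat -> nat -> Prop) :
    seq prog -> seq nat -> seq nat -> Prop :=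
| evals_nil s : evals O [::] s [::]
| evals_cons g gs s y ys :
    eval O g s y -> evals O gs s ys -> evals O (g :: gs) s (y :: ys).

Record problem := Problem {
  instance : Type;
  code : instance -> nat;
  yes : instance -> Prop
}.

Definition restrict (P : problem) (R : instance P -> Prop) : problem :=
  {| instance := {x : instance P | R x};
     code := fun x => code (sval x);
     yes := fun x => yes (sval x) |}.

Definition oracle (P : problem) (c y : nat) : Prop :=
  exists2 x : instance P, c = code x
    & (yes x /\ y = 1%N) \/ (~ yes x /\ y = 0%N).

(* Turing reducibility: a decision procedure for [P] that may query [Q], only
   on codes of instances of [Q]. *)
Definition reducible (P Q : problem) : Prop :=
  exists p : prog, forall x : instance P,
    (yes x -> eval (oracle Q) p [:: code x] 1%N) /\
    (~ yes x -> eval (oracle Q) p [:: code x] 0%N).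

(* All encodings are built from the computable bijection
   [CodeSeq.code : seq nat -> nat], rationals being in lowest terms. *)
Definition code_int (z : int) : nat :=
  match z with Posz n => n.*2 | Negz n => n.*2.+1 end.

Definition code_rat (r : rat) : nat :=
  CodeSeq.code [:: code_int (numq r); code_int (denq r)].

Definition code_vec (d : nat) (v : 'I_d -> rat) : nat :=
  CodeSeq.code [seq code_rat (v i) | i <- enum 'I_d].

Definition code_mx (m n : nat) (A : 'M[rat]_(m, n)) : nat :=
  CodeSeq.code [seq code_vec (A i) | i <- enum 'I_m].

Record lrs := Lrs {
  lrs_order : nat;
  lrs_coef : 'I_lrs_order -> rat;
  lrs_seq :> nat -> rat;
  lrs_order_gt0 : (1 <= lrs_order)%N;
  lrs_rec : forall n : nat,
    lrs_seq (n + lrs_order)%N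
      = \sum_(i < lrs_order) lrs_coef i * lrs_seq (n + i)%N
}.

Definition code_lrs (u : lrs) : nat :=
  CodeSeq.code [:: lrs_order u; code_vec (@lrs_coef u);
                   code_vec (fun i : 'I_(lrs_order u) => u i)].

Definition positivity : problem :=
  {| instance := lrs;
     code := code_lrs;
     yes := fun u => forall n : nat, 0 <= u n |}.

(* The weight polynomial is presented by a finite list of terms. *)
Record energy_instance := EnergyInstance {
  dim : nat;
  trans : 'M[rat]_dim;
  start : 'cV[rat]_dim;
  bound : rat;
  terms : seq (rat * 'X_{1.. dim})
}.

Definition weight (I : energy_instance) : {mpoly rat[dim I]} :=
  \sum_(t <- terms I) t.1 *: 'X_[t.2].

Definition code_term (d : nat) (t : rat * 'X_{1.. d}) : nat :=
  CodeSeq.code [:: code_rat t.1; CodeSeq.code [seq t.2 i | i <- enum 'I_d]].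

Definition code_energy (I : energy_instance) : nat :=
  CodeSeq.code [:: dim I; code_mx (trans I); code_mx (start I);
                   code_rat (bound I);
                   CodeSeq.code [seq code_term t | t <- terms I]].

Definition energy_satisfaction : problem :=
  {| instance := energy_instance;
     code := code_energy;
     yes := fun I => exists n : nat,
       \sum_(0 <= k < n.+1)
          (weight I).@[fun i => (trans I ^+ k *m start I) i 0] < bound I |}.

Definition markov_chain (d : nat) (M : 'M[rat]_d) (q : 'cV[rat]_d) : Prop :=
  [/\ forall i j, 0 <= M i j, forall i, 0 <= q i 0,
      forall j, \sum_i M i j = 1 & \sum_i q i 0 = 1].

(* A linear form: homogeneous of degree 1, or zero. *)
Definition linear_weight (d : nat) (w : {mpoly rat[d]}) : Prop :=
  w \is 1.-homog.

(* Main.v *)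
(* Let [u] satisfy a recurrence of order [d], and put [u'_0 = 0] and
   [u'_(n+1) = u_n], which has order [d + 1].  Each coordinate of the state
   vector of [u'] is split into a positive and a negative part, so that its
   companion matrix becomes a non-negative matrix; dividing by a large integer
   makes the column sums at most 1, and an absorbing state of weight 0 takes
   the missing mass.  The difference of the two parts of coordinate [i] after
   [k] steps is then [rho^(k+1) u'_(k+i)] for some [rho > 0].  The weight
   [rho y_1 - y_0], up to a positive factor, makes the energy telescope to a
   positive multiple of [u_n], so that bound 0 is crossed iff some [u_n < 0].

   All entries are written over one common denominator, so that the only
   arithmetic the reducing program needs is that of natural numbers. *)
From Stdlib Require Import Classical.
Require Import Defs.
From mathcomp Require Import all_boot all_order all_algebra.
From mathcomp Require Import mpoly ring zify.

Set Implicit Arguments.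
Unset Strict Implicit.
Unset Printing Implicit Defensive.

(** * Computable functions of fixed arity and their basic closure properties *)

Fixpoint env (k : nat) : Type :=
  if k is k'.+1 then (nat * env k')%type else unit.

Fixpoint args k : env k -> seq nat :=
  if k is k'.+1 then fun e : env k'.+1 => e.1 :: args e.2 else fun _ => [::].

(** The program is chosen before the oracle, so that it can later be combined with [Query] whatever
    the oracle is. *)
Definition computable k (f : env k -> nat) : Prop :=
  exists p, forall O e, eval O p (args e) (f e).

Lemma eq_computable k (f g : env k -> nat) :
  f =1 g -> computable f -> computable g.
Proof. by move=> fg [p pP]; exists p => O e; rewrite -fg. Qed.

Lemma size_args k (e : env k) : size (args e) = k.
Proof. by elim: k e => //= k IH e; rewrite IH. Qed.

(** These projections forward the arguments from position [i] on; a program is thereby called in a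
    larger environment whose leading entries are dropped. *)
Lemma evals_proj O s i n : i + n = size s ->
  evals O [seq Proj j | j <- iota i n] s (drop i s).
Proof.
elim: n i => [|n IH] i /= ins.
  by rewrite drop_oversize -?ins ?addn0 //; exact: evals_nil.
have lt_is : i < size s by rewrite -ins addnS ltnS leq_addr.
rewrite (drop_nth 0 lt_is); apply: evals_cons; first exact: eval_Proj.
by apply: IH; rewrite addSnnS.
Qed.

Lemma computable_fst k : computable (fun e : env k.+1 => e.1).
Proof. by exists (Proj 0) => O e; exact: eval_Proj. Qed.

Lemma computable_weaken k (f : env k -> nat) :
  computable f -> computable (fun e : env k.+1 => f e.2).
Proof.
case=> p pP; exists (Comp p [seq Proj j | j <- iota 1 k]) => O e.
apply: eval_Comp (pP O e.2).
have := @evals_proj O (args e) 1 k; rewrite size_args /= drop0.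
exact.
Qed.

Lemma computable_succ k (f : env k -> nat) :
  computable f -> computable (fun e => (f e).+1).
Proof.
case=> p pP; exists (Comp Succ [:: p]) => O e.
by apply: eval_Comp (eval_Succ _ _ [::]); apply: evals_cons;
  last exact: evals_nil.
Qed.

Lemma computable_const k n : computable (fun _ : env k => n).
Proof.
elim: n => [|n]; last exact: computable_succ.
by exists Zero => O e; exact: eval_Zero.
Qed.

(** [iteri] has the shape of [Rec]: the step receives the counter, then the accumulated value, then
    the parameters. The arithmetic below is obtained from it. *)
Lemma computable_iteri k (n b : env k -> nat) (g : nat -> nat -> env k -> nat) :
  computable n -> computable b ->
  computable (fun e : env k.+2 => g e.1 e.2.1 e.2.2) ->
  computable (fun e => iteri (n e) (fun i r => g i r e) (b e)).
Proof.
case=> [pn nP] [pb bP] [pg gP].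
exists (Comp (Rec pb pg) (pn :: [seq Proj j | j <- iota 0 k])) => O e.
apply: (@eval_Comp _ _ _ _ (n e :: args e)).
  apply: evals_cons; first exact: nP.
  by have := @evals_proj O (args e) 0 k; rewrite size_args drop0; apply.
elim: (n e) => [|m IH] /=; first by apply: eval_Rec0; exact: bP.
by apply: eval_RecS IH _; exact: (gP O (m, (_, e))).
Qed.

Lemma computable_comp1 (f : nat -> nat) k (a : env k -> nat) :
  computable (fun e : env 1 => f e.1) -> computable a ->
  computable (fun e => f (a e)).
Proof.
case=> [p pP] [pa aP]; exists (Comp p [:: pa]) => O e.
apply: (eval_Comp _ (pP O (a e, tt))).
by apply: evals_cons; last exact: evals_nil.
Qed.

Lemma computable_comp2 (f : nat -> nat -> nat) k (a b : env k -> nat) :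
  computable (fun e : env 2 => f e.1 e.2.1) -> computable a -> computable b ->
  computable (fun e => f (a e) (b e)).
Proof.
case=> [p pP] [pa aP] [pb bP]; exists (Comp p [:: pa; pb]) => O e.
apply: (eval_Comp _ (pP O (a e, (b e, tt)))).
by do 2![apply: evals_cons => //]; exact: evals_nil.
Qed.

Lemma computable_comp3 (f : nat -> nat -> nat -> nat) k (a b c : env k -> nat) :
  computable (fun e : env 3 => f e.1 e.2.1 e.2.2.1) ->
  computable a -> computable b -> computable c ->
  computable (fun e => f (a e) (b e) (c e)).
Proof.
case=> [p pP] [pa aP] [pb bP] [pc cP]; exists (Comp p [:: pa; pb; pc]) => O e.
apply: (eval_Comp _ (pP O (a e, (b e, (c e, tt))))).
by do 3![apply: evals_cons => //]; exact: evals_nil.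
Qed.

Lemma computable_snd1 k : computable (fun e : env k.+2 => e.2.1).
Proof. exact: computable_weaken (computable_fst k). Qed.

Lemma computable_snd2 k : computable (fun e : env k.+3 => e.2.2.1).
Proof. exact: computable_weaken (computable_snd1 k). Qed.

Lemma computable_snd3 k : computable (fun e : env k.+4 => e.2.2.2.1).
Proof. exact: computable_weaken (computable_snd2 k). Qed.

(** * Arithmetic, tests and bounded big operators *)

Lemma computable_add k (a b : env k -> nat) :
  computable a -> computable b -> computable (fun e => a e + b e).
Proof.
move=> ca cb.
apply: (@eq_computable _ (fun e => iteri (b e) (fun _ r => r.+1) (a e))).
  by move=> e; elim: (b e) => [|n /= ->]; rewrite ?addn0 ?addnS.
apply: (computable_iteri (g := fun _ r _ => r.+1)) => //.
exact/computable_succ/computable_snd1.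
Qed.

Lemma computable_mul k (a b : env k -> nat) :
  computable a -> computable b -> computable (fun e => a e * b e).
Proof.
move=> ca cb.
apply: (@eq_computable _ (fun e => iteri (b e) (fun _ r => r + a e) 0)).
  by move=> e; elim: (b e) => [|n /= ->]; rewrite ?muln0 ?mulnSr.
apply: (computable_iteri (g := fun _ r e => r + a e)) => //.
  exact: computable_const.
apply: computable_add; first exact: computable_snd1.
exact: computable_weaken (computable_weaken ca).
Qed.

Lemma computable_exp k (a b : env k -> nat) :
  computable a -> computable b -> computable (fun e => a e ^ b e).
Proof.
move=> ca cb.
apply: (@eq_computable _ (fun e => iteri (b e) (fun _ r => r * a e) 1)).
  by move=> e; elim: (b e) => [|n /= ->]; rewrite ?expnSr.
apply: (computable_iteri (g := fun _ r e => r * a e)) => //.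
  exact: computable_const.
apply: computable_mul; first exact: computable_snd1.
exact: computable_weaken (computable_weaken ca).
Qed.

Lemma computable_pred k (a : env k -> nat) :
  computable a -> computable (fun e => (a e).-1).
Proof.
(* The step returns its counter, and the last counter is the predecessor. *)
move=> ca; apply: (@eq_computable _ (fun e => iteri (a e) (fun i _ => i) 0)).
  by move=> e; case: (a e).
apply: (computable_iteri (g := fun i _ _ => i)) => //.
  exact: computable_const.
exact: computable_fst.
Qed.

Lemma computable_sub k (a b : env k -> nat) :
  computable a -> computable b -> computable (fun e => a e - b e).
Proof.
move=> ca cb.
apply: (@eq_computable _ (fun e => iteri (b e) (fun _ r => r.-1) (a e))).
  by move=> e; elim: (b e) => [|n /= ->]; rewrite ?subn0 ?subnS.
apply: (computable_iteri (g := fun _ r _ => r.-1)) => //.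
exact/computable_pred/computable_snd1.
Qed.

Lemma computable_if k (t : env k -> bool) (a b : env k -> nat) :
  computable (fun e => t e : nat) -> computable a -> computable b ->
  computable (fun e => if t e then a e else b e).
Proof.
move=> ct ca cb.
(* A conditional is a loop run once or not at all. *)
apply: (@eq_computable _ (fun e => iteri (t e) (fun _ _ => a e) (b e))).
  by move=> e; case: (t e).
apply: (computable_iteri (g := fun _ _ e => a e)) => //.
exact: computable_weaken (computable_weaken ca).
Qed.

Lemma computable_leq k (a b : env k -> nat) :
  computable a -> computable b -> computable (fun e => (a e <= b e : nat)).
Proof.
move=> ca cb; apply: (@eq_computable _ (fun e => 1 - (a e - b e))).
  by move=> e; rewrite -subn_eq0; case: (a e - b e).
exact: computable_sub (computable_const _ 1) (computable_sub ca cb).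
Qed.

Lemma computable_and k (s t : env k -> bool) :
  computable (fun e => s e : nat) -> computable (fun e => t e : nat) ->
  computable (fun e => (s e && t e : nat)).
Proof.
move=> cs ct; apply: eq_computable (computable_mul cs ct) => e.
by case: (s e); case: (t e).
Qed.

Lemma computable_eq k (a b : env k -> nat) :
  computable a -> computable b -> computable (fun e => (a e == b e : nat)).
Proof.
move=> ca cb.
apply: eq_computable
  (computable_and (computable_leq ca cb) (computable_leq cb ca)) => e.
by rewrite eqn_leq.
Qed.

(** One recursion serves sums, products and maxima; the hypothesis on splitting off the last term
    replaces a monoid structure on [op]. *)
Lemma computable_big (op : nat -> nat -> nat) x k (n : env k -> nat)
    (F : nat -> env k -> nat) :
  (forall j (a b : env j -> nat), computable a -> computable b ->
     computable (fun e => op (a e) (b e))) ->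
  (forall m f, \big[op/x]_(0 <= i < m.+1) f i
     = op (\big[op/x]_(0 <= i < m) f i) (f m)) ->
  computable n -> computable (fun e : env k.+1 => F e.1 e.2) ->
  computable (fun e => \big[op/x]_(0 <= i < n e) F i e).
Proof.
move=> cop recr cn [p pP].
apply: (@eq_computable _ (fun e => iteri (n e) (fun i r => op r (F i e)) x)).
  by move=> e; elim: (n e) => [|m /= ->]; [rewrite big_geq | rewrite recr].
apply: (computable_iteri (g := fun i r e => op r (F i e))) => //.
  exact: computable_const.
apply: cop; first exact: computable_snd1.
(* Position 1 holds the accumulated value, which [F] must not see. *)
exists (Comp p (Proj 0 :: [seq Proj j | j <- iota 2 k])) => O e.
apply: (eval_Comp _ (pP O (e.1, e.2.2))).
apply: evals_cons; first exact: eval_Proj.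
by have := @evals_proj O (args e) 2 k; rewrite size_args /= drop0; apply.
Qed.

Lemma computable_sum k (n : env k -> nat) (F : nat -> env k -> nat) :
  computable n -> computable (fun e : env k.+1 => F e.1 e.2) ->
  computable (fun e => \sum_(0 <= i < n e) F i e).
Proof.
apply: computable_big => [|m f]; first exact: computable_add.
exact: big_nat_recr.
Qed.

Lemma computable_prod k (n : env k -> nat) (F : nat -> env k -> nat) :
  computable n -> computable (fun e : env k.+1 => F e.1 e.2) ->
  computable (fun e => \prod_(0 <= i < n e) F i e).
Proof.
apply: computable_big => [|m f]; first exact: computable_mul.
exact: big_nat_recr.
Qed.

Lemma computable_max k (n : env k -> nat) (F : nat -> env k -> nat) :
  computable n -> computable (fun e : env k.+1 => F e.1 e.2) ->
  computable (fun e => \max_(0 <= i < n e) F i e).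
Proof.
apply: computable_big => [j a b ca cb|m f]; last exact: big_nat_recr.
apply: eq_computable (computable_add ca (computable_sub cb ca)) => e.
by rewrite maxnE.
Qed.

(** * Building codes of lists *)

Lemma computable_code_nil k : computable (fun _ : env k => CodeSeq.code [::]).
Proof. exact: computable_const. Qed.

(** [CodeSeq.code] is a right fold of [2 ^ a * (2 m + 1)] starting from 0. *)
Lemma computable_code_cons k (a : env k -> nat) (s : env k -> seq nat) :
  computable a -> computable (fun e => CodeSeq.code (s e)) ->
  computable (fun e => CodeSeq.code (a e :: s e)).
Proof.
move=> ca cs.
apply: eq_computable (computable_mul (computable_exp (computable_const _ 2) ca)
  (computable_succ (computable_add cs cs))) => e.
by rewrite addnn.
Qed.

(** Since the code is a right fold, the loop builds the list from its end: round [i] prepends the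
    entry of index [n - i - 1]. *)
Lemma computable_code_mkseq k (n : env k -> nat) (F : nat -> env k -> nat) :
  computable n -> computable (fun e : env k.+1 => F e.1 e.2) ->
  computable (fun e => CodeSeq.code (mkseq (fun i => F i e) (n e))).
Proof.
move=> cn [p pP].
pose step i r e := 2 ^ F (n e - i.+1) e * (r + r).+1.
apply: (@eq_computable _ (fun e => iteri (n e) (fun i r => step i r e) 0)).
  move=> e; have: forall m, m <= n e -> iteri m (fun i r => step i r e) 0 =
      CodeSeq.code (map (fun i => F i e) (iota (n e - m) m)).
    elim=> [|m IH] mn //=; rewrite IH 1?ltnW // /step addnn.
    by rewrite subnSK.
  by move=> ->; rewrite ?subnn.
apply: computable_iteri => //; first exact: computable_const.
rewrite /step; apply: computable_mul.
  apply: computable_exp; first exact: computable_const.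
  have [pi piP] : computable (fun e : env k.+2 => n e.2.2 - e.1.+1).
    apply: computable_sub.
      exact: computable_weaken (computable_weaken cn).
    exact: computable_succ (computable_fst _).
  exists (Comp p (pi :: [seq Proj j | j <- iota 2 k])) => O e.
  apply: (eval_Comp _ (pP O (_, e.2.2))); apply: evals_cons; first exact: piP.
  by have := @evals_proj O (args e) 2 k; rewrite size_args /= drop0; apply.
apply: computable_succ.
by apply: computable_add; exact: computable_snd1.
Qed.

(** * Division, divisibility and gcd by bounded counting and search *)

Lemma sum_ltn m n : \sum_(0 <= i < m) (i < n) = minn m n.
Proof.
elim: m => [|m IH]; first by rewrite big_geq ?min0n.
by rewrite big_nat_recr //= IH; case: (ltnP m n); lia.
Qed.

Lemma computable_div k (a b : env k -> nat) :
  computable a -> computable b -> computable (fun e => a e %/ b e).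
Proof.
apply: computable_comp2.
(* The quotient of [m] by [d] counts the [i < m] with [(i + 1) d <= m]; the guard [0 < d] matches
   the convention [m %/ 0 = 0]. *)
apply: (@eq_computable 2 (fun e =>
    \sum_(0 <= i < e.1) ((0 < e.2.1) && (i.+1 * e.2.1 <= e.1) : nat))).
  move=> [m [d _]] /=.
  have [->|d_gt0] := posnP d; first by rewrite divn0 big1 /=.
  under eq_bigr => i _ do rewrite -leq_divRL //.
  by rewrite sum_ltn (minn_idPr _) ?leq_div.
apply: (computable_sum (F := fun i (e : env 2) =>
  ((0 < e.2.1) && (i.+1 * e.2.1 <= e.1) : nat))); first exact: computable_fst.
apply: computable_and; apply: computable_leq.
- exact: computable_const.
- exact: computable_snd2.
- apply: computable_mul; last exact: computable_snd2.
  exact: computable_succ (computable_fst _).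
- exact: computable_snd1.
Qed.

Lemma computable_mod k (a b : env k -> nat) :
  computable a -> computable b -> computable (fun e => a e %% b e).
Proof.
move=> ca cb.
apply: eq_computable
  (computable_sub ca (computable_mul (computable_div ca cb) cb)) => e.
by rewrite {1}(divn_eq (a e) (b e)) addKn.
Qed.

Lemma computable_dvd k (a b : env k -> nat) :
  computable a -> computable b -> computable (fun e => (a e %| b e : nat)).
Proof.
by move=> ca cb; apply/computable_eq/computable_const/computable_mod.
Qed.

Lemma computable_double k (a : env k -> nat) :
  computable a -> computable (fun e => (a e).*2).
Proof.
by move=> ca; apply: eq_computable (computable_add ca ca) => e; rewrite addnn.
Qed.

Lemma computable_half k (a : env k -> nat) :
  computable a -> computable (fun e => (a e)./2).
Proof.
move=> ca; apply: eq_computable (computable_div ca (computable_const _ 2)) => e.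
by rewrite divn2.
Qed.

Lemma computable_odd k (a : env k -> nat) :
  computable a -> computable (fun e => odd (a e) : nat).
Proof.
move=> ca; apply: eq_computable (computable_mod ca (computable_const _ 2)) => e.
by rewrite modn2.
Qed.

Lemma computable_gcd k (a b : env k -> nat) :
  computable a -> computable b -> computable (fun e => gcdn (a e) (b e)).
Proof.
(* The largest common divisor is sought up to [m + n], a bound that stays valid when one argument is
   0; for [m = n = 0] only the candidate 0 remains. *)
apply: computable_comp2; apply: (@eq_computable 2 (fun e =>
    \max_(0 <= g < (e.1 + e.2.1).+1) g * ((g %| e.1) && (g %| e.2.1)))).
  move=> [m [n _]] /=; case: (posnP (m + n)) => [|mn_gt0].
    by move/eqP; rewrite addn_eq0 => /andP[/eqP-> /eqP->]; rewrite big_nat1.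
  have g_gt0 : 0 < gcdn m n by rewrite gcdn_gt0 -addn_gt0.
  rewrite big_mkord; apply/eqP; rewrite eqn_leq; apply/andP; split.
    apply/bigmax_leqP => g _; rewrite -dvdn_gcd.
    by case: (boolP (g %| _)) => [/dvdn_leq|_]; rewrite ?muln1 ?muln0 //; apply.
  have lt_g : gcdn m n < (m + n).+1.
    rewrite ltnS; have [m0|m_gt0] := posnP m; first by rewrite m0 gcd0n.
    by rewrite (leq_trans (dvdn_leq m_gt0 (dvdn_gcdl _ _))) ?leq_addr.
  apply: leq_trans (leq_bigmax (Ordinal lt_g)) => /=.
  by rewrite dvdn_gcdl dvdn_gcdr muln1.
apply: (computable_max (F := fun g (e : env 2) =>
  g * ((g %| e.1) && (g %| e.2.1)))).
  apply: computable_succ.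
  exact: computable_add (computable_fst _) (computable_snd1 _).
apply: computable_mul; first exact: computable_fst.
apply: computable_and; apply: computable_dvd.
- exact: computable_fst.
- exact: computable_snd1.
- exact: computable_fst.
- exact: computable_snd2.
Qed.

(** * Decoding lists *)

Definition code_head (c : nat) : nat := logn 2 c.
(** The odd part of the code of a nonempty list is [2 m + 1], where [m] is the code of the tail. *)
Definition code_behead (c : nat) : nat := (c %/ 2 ^ logn 2 c)./2.
Definition code_nth (c i : nat) : nat := code_head (iter i code_behead c).

Lemma code_head_cons x s : code_head (CodeSeq.code (x :: s)) = x.
Proof.
rewrite /code_head /= lognM ?expn_gt0 // pfactorK // logn_coprime ?addn0 //.
by rewrite coprime2n /= odd_double.
Qed.

Lemma code_behead_cons x s :
  code_behead (CodeSeq.code (x :: s)) = CodeSeq.code s.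
Proof.
rewrite /code_behead -[logn 2 _]/(code_head _) code_head_cons /=.
by rewrite mulKn ?expn_gt0 //= uphalf_double.
Qed.

Lemma code_nthE s i : code_nth (CodeSeq.code s) i = nth 0 s i.
Proof.
rewrite /code_nth; elim: s i => [|x s IH] i.
  (* The empty list has code 0, which [code_behead] fixes and whose head is 0: reading past the end
     yields the default 0. *)
  by rewrite nth_nil (_ : iter _ _ _ = 0) //; elim: i => //= i ->.
case: i => [|i]; first exact: code_head_cons.
by rewrite iterSr code_behead_cons IH.
Qed.

Lemma computable_code_nth k (a b : env k -> nat) :
  computable a -> computable b -> computable (fun e => code_nth (a e) (b e)).
Proof.
have computable_logn2 j (c : env j -> nat) :
    computable c -> computable (fun e => logn 2 (c e)).
  apply: computable_comp1.
  (* The valuation of [c] counts the [i < c] for which [2 ^ (i + 1)] divides [c]. *)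
  apply: (@eq_computable 1 (fun e => \sum_(0 <= i < e.1) (2 ^ i.+1 %| e.1))).
    move=> [c' []] /=; have [->|c_gt0] := posnP c'; first by rewrite big_geq.
    under eq_bigr => i _ do rewrite pfactor_dvdn //.
    by rewrite sum_ltn (minn_idPr _) // ltnW // ltn_logl.
  apply: (computable_sum (F := fun i (e : env 1) => 2 ^ i.+1 %| e.1)).
    exact: computable_fst.
  apply: computable_dvd; last exact: computable_snd1.
  apply: computable_exp; first exact: computable_const.
  exact: computable_succ (computable_fst _).
apply: computable_comp2; apply: (computable_logn2).
apply: (@eq_computable 2 (fun e => iteri e.2.1 (fun _ => code_behead) e.1)).
  by move=> e; elim: e.2.1 => //= n ->.
apply: (computable_iteri (g := fun _ r _ => code_behead r)).
- exact: computable_snd1.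
- exact: computable_fst.
- apply: computable_half; apply: computable_div; first exact: computable_snd1.
  apply: computable_exp; first exact: computable_const.
  exact: computable_logn2 (computable_snd1 _).
Qed.

(** Follows the syntax of the function. Hypotheses are tried before the closure lemmas, so the
    computability of auxiliary functions can be supplied through the context. *)
Ltac computability := cbv beta; first
  [ assumption
  | match goal with H : _ |- _ => simple apply H; computability end
  | exact: computable_fst | exact: computable_snd1 | exact: computable_snd2
  | exact: computable_snd3
  | simple apply computable_const
  | simple apply computable_succ; computability
  | simple apply computable_pred; computability
  | simple apply computable_add; computability
  | simple apply computable_mul; computability
  | simple apply computable_sub; computability
  | simple apply computable_div; computability
  | simple apply computable_double; computability
  | simple apply computable_half; computability
  | simple apply computable_odd; computability
  | simple apply computable_gcd; computability
  | simple apply computable_leq; computability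
  | simple apply computable_eq; computability
  | simple apply computable_code_nth; computability
  | simple apply computable_if; computability
  | simple apply computable_sum; computability
  | simple apply computable_prod; computability
  | simple apply computable_code_cons; computability
  | simple apply computable_code_nil; computability
  | simple apply computable_code_mkseq; computability ].

(** * The reduction as a function on codes *)

(* [v] is the code of a vector of rationals.  Since [code_int z] is [2 z] or
   [2 |z| - 1], its upper half is [|z|] and its parity is the sign. *)
Definition num (v i : nat) : nat := code_nth (code_nth v i) 0.
Definition den (v i : nat) : nat := (code_nth (code_nth v i) 1)./2.

(* [P * |v_i|], where [P] is a multiple of all denominators. *)
Definition absn (P v i : nat) : nat := (num v i).+1./2 * (P %/ den v i).

(* [P] times the positive ([s] even) or negative ([s] odd) part of [v_i]. *)
Definition part (P v s i : nat) : nat :=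
  if odd (num v i + s) then 0 else absn P v i.

Definition ord_of c := code_nth c 0.
Definition coef_of c := code_nth c 1.
Definition init_of c := code_nth c 2.

Definition com_den (c : nat) : nat :=
  (\prod_(0 <= i < ord_of c) den (coef_of c) i) *
  (\prod_(0 <= i < ord_of c) den (init_of c) i).

(** The large integer that everything is divided by. With [P] the common denominator, the first two
    summands bound each column sum of [trans0], and the third bounds the total of [start0]. *)
Definition scale (c : nat) : nat :=
  com_den c + \sum_(0 <= i < ord_of c) absn (com_den c) (coef_of c) i
            + \sum_(0 <= i < ord_of c) absn (com_den c) (init_of c) i.

(* States [2 i] and [2 i + 1] carry the positive and the negative part of
   coordinate [i] of the shifted sequence, so that in [trans0] and [start0] the
   coefficient and initial term of index [i] belong to coordinate [i + 1];
   the absorbing state comes last. *)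
Definition trans0 (c i j : nat) : nat :=
  if j./2 == 0 then 0
  else if i./2 < ord_of c then (if j == i.+2 then com_den c else 0)
  else part (com_den c) (coef_of c) (i + j) (j./2).-1.

Definition start0 (c i : nat) : nat :=
  if i./2 == 0 then 0 else part (com_den c) (init_of c) i (i./2).-1.

Definition absorbing (c : nat) : nat := (ord_of c).+1.*2.

Definition complete (c : nat) (f : nat -> nat) (i : nat) : nat :=
  if i < absorbing c then f i else scale c - \sum_(0 <= k < absorbing c) f k.

(** Lowest terms are required by [code_rat]; doubling is [code_int] on non-negative integers. *)
Definition code_frac (m n : nat) : nat :=
  CodeSeq.code [:: (m %/ gcdn m n).*2; (n %/ gcdn m n).*2].

Definition code_unit_term (r n i : nat) : nat :=
  CodeSeq.code [:: r; CodeSeq.code (mkseq (fun j => (i == j) : nat) n)].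

(** The list [[:: 0; 2]] codes the rational 0, and [k.-1.*2.+1] is [code_int] of [- k] for [k > 0].
    With [P = com_den c] and [N = scale c], the weights [-N, N, P, -P] on states 0 to 3 give
    [P y_1 - N y_0], which is [N (rho y_1 - y_0)] for [rho = P / N]. *)
Definition reduction (c : nat) : nat :=
  let n := (absorbing c).+1 in
  CodeSeq.code [:: n;
    CodeSeq.code (mkseq (fun i => CodeSeq.code (mkseq (fun j =>
      code_frac (complete c (trans0 c ^~ j) i) (scale c)) n)) n);
    CodeSeq.code (mkseq (fun i =>
      CodeSeq.code [:: code_frac (complete c (start0 c) i) (scale c)]) n);
    CodeSeq.code [:: 0; 2];
    CodeSeq.code [::
      code_unit_term (CodeSeq.code [:: (scale c).-1.*2.+1; 2]) n 0;
      code_unit_term (CodeSeq.code [:: (scale c).*2; 2]) n 1;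
      code_unit_term (CodeSeq.code [:: (com_den c).*2; 2]) n 2;
      code_unit_term (CodeSeq.code [:: (com_den c).-1.*2.+1; 2]) n 3]].

(** * Computability of the reduction *)

Lemma computable_part k (a b s t : env k -> nat) :
  computable a -> computable b -> computable s -> computable t ->
  computable (fun e => part (a e) (b e) (s e) (t e)).
Proof. by move=> *; rewrite /part /absn /num /den; computability. Qed.

Lemma computable_com_den k (a : env k -> nat) :
  computable a -> computable (fun e => com_den (a e)).
Proof.
apply: computable_comp1.
by rewrite /com_den /coef_of /init_of /ord_of /den; computability.
Qed.

Lemma computable_scale k (a : env k -> nat) :
  computable a -> computable (fun e => scale (a e)).
Proof.
apply: computable_comp1; have := @computable_com_den.
rewrite /scale /absn /num /den /coef_of /init_of /ord_of => cP.
computability.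
Qed.

Lemma computable_trans0 k (a b c : env k -> nat) :
  computable a -> computable b -> computable c ->
  computable (fun e => trans0 (a e) (b e) (c e)).
Proof.
apply: computable_comp3; have := @computable_com_den; have := @computable_part.
by rewrite /trans0 /ord_of /coef_of => *; computability.
Qed.

Lemma computable_start0 k (a b : env k -> nat) :
  computable a -> computable b ->
  computable (fun e => start0 (a e) (b e)).
Proof.
apply: computable_comp2; have := @computable_com_den; have := @computable_part.
by rewrite /start0 /init_of => *; computability.
Qed.

Lemma computable_reduction : computable (fun e : env 1 => reduction e.1).
Proof.
have := @computable_com_den; have := @computable_scale.
have := @computable_trans0; have := @computable_start0.
rewrite /reduction /code_unit_term /code_frac /complete /absorbing /ord_of => *.
computability.
Qed.

(** * Meaning of the codes of rationals and vectors *)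

Import Order.TTheory GRing.Theory Num.Theory.
Local Open Scope ring_scope.

Lemma map_enum_ord (T : Type) n (F : 'I_n -> T) (f : nat -> T) :
  (forall i, F i = f i) -> [seq F i | i <- enum 'I_n] = mkseq f n.
Proof.
by move=> Ff; rewrite (eq_map Ff) (map_comp f val) val_enum_ord.
Qed.

Lemma nth_code_vec d (v : 'I_d -> rat) (i : 'I_d) :
  code_nth (code_vec v) i = code_rat (v i).
Proof.
rewrite code_nthE (nth_map i) ?size_enum_ord //; congr (code_rat (v _)).
by apply: val_inj; rewrite /= nth_enum_ord.
Qed.

Lemma num_code_vec d (v : 'I_d -> rat) (i : 'I_d) :
  num (code_vec v) i = code_int (numq (v i)).
Proof. by rewrite /num nth_code_vec code_nthE. Qed.

Lemma den_code_vec d (v : 'I_d -> rat) (i : 'I_d) :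
  den (code_vec v) i = `|denq (v i)|%N.
Proof.
rewrite /den nth_code_vec code_nthE /=.
by case: (denq _) (denq_gt0 (v i)) => // n _; rewrite /= doubleK.
Qed.

(** Thanks to this default, the column of the absorbing state in [trans0], which reads a coefficient
    past the end, vanishes without a case of its own. *)
Lemma num_code_vec_oversize d (v : 'I_d -> rat) i :
  (d <= i)%N -> num (code_vec v) i = 0%N.
Proof.
move=> di; rewrite /num [code_nth (code_vec v) i]code_nthE.
rewrite nth_default; first exact: (code_nthE [::] 0%N).
by rewrite size_map size_enum_ord.
Qed.

Lemma part_odd P v s t i : odd s = odd t -> part P v s i = part P v t i.
Proof. by rewrite /part !oddD => ->. Qed.

Lemma part_add P v s i : (part P v s i + part P v s.+1 i)%N = absn P v i.
Proof. by rewrite /part addnS /=; case: odd; rewrite ?addn0 ?add0n. Qed.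

(** Divisibility makes the quotient inside [absn] exact, so two natural numbers represent the signed
    rational. *)
Lemma part_sub d (v : 'I_d -> rat) P (i : 'I_d) :
  (den (code_vec v) i %| P)%N ->
  (part P (code_vec v) 0 i)%:R - (part P (code_vec v) 1 i)%:R
    = P%:R * v i :> rat.
Proof.
rewrite /part /absn addn0 addn1 /= num_code_vec den_code_vec => dP.
have d_neq0 : `|denq (v i)|%N%:R != 0 :> rat.
  by rewrite pnatr_eq0 absz_eq0 denq_eq0.
have vE : v i = (numq (v i))%:~R / `|denq (v i)|%N%:R.
  by rewrite pmulrn absz_denq divq_num_den.
rewrite [in RHS]vE; move: dP d_neq0; set D := `|_|%N => dP d_neq0.
case: (numq (v i)) => n /=; rewrite odd_double /= ?uphalf_double ?doubleK.
  by rewrite subr0 natrM natq_div // -pmulrn; ring.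
by rewrite sub0r natrM natq_div // NegzE mulrNz -pmulrn; ring.
Qed.

Lemma big_double (R : Type) (x : R) (op : Monoid.law x) n (F : nat -> R) :
  \big[op/x]_(0 <= k < n.*2) F k =
  \big[op/x]_(0 <= k < n) op (F k.*2) (F k.*2.+1).
Proof.
elim: n => [|n IH]; first by rewrite !big_geq.
by rewrite doubleS !big_nat_recr //= IH Monoid.mulmA.
Qed.

Lemma code_frac_rat m n : (0 < n)%N -> code_rat (m%:R / n%:R) = code_frac m n.
Proof.
move=> n_gt0; have g_gt0 : (0 < gcdn m n)%N by rewrite gcdn_gt0 n_gt0 orbT.
have g_neq0 : (gcdn m n)%:R != 0 :> rat by rewrite pnatr_eq0 -lt0n.
have -> : m%:R / n%:R = (m %/ gcdn m n)%N%:R / (n %/ gcdn m n)%N%:R :> rat.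
  rewrite !natq_div ?dvdn_gcdl ?dvdn_gcdr // invfM invrK mulrACA.
  by rewrite mulVf ?mulr1.
have cop : coprime (m %/ gcdn m n) (n %/ gcdn m n).
  rewrite /coprime -(eqn_pmul2l g_gt0) muln1 muln_gcdr.
  by rewrite !(mulnC (gcdn m n)) !divnK ?dvdn_gcdl ?dvdn_gcdr.
have ng_gt0 : (0 < n %/ gcdn m n)%N by rewrite divn_gt0 // dvdn_leq ?dvdn_gcdr.
rewrite !pmulrn /code_rat coprimeq_num ?coprimeq_den //=.
by rewrite eqz_nat gtn_eqF // gtr0_sg ?mul1r.
Qed.

Lemma code_rat_nat n : code_rat n%:R = CodeSeq.code [:: n.*2; 2]%N.
Proof. by rewrite pmulrn /code_rat numq_int denq_int. Qed.

Lemma code_rat_oppn n :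
  (0 < n)%N -> code_rat (- n%:R) = CodeSeq.code [:: n.-1.*2.+1; 2]%N.
Proof.
case: n => // n _.
by rewrite pmulrn -mulrNz -NegzE /code_rat numq_int denq_int.
Qed.

(** * Integer column sums and their bound [scale] *)

Lemma sum_complete c f :
  (\sum_(0 <= k < absorbing c) f k <= scale c)%N ->
  (\sum_(0 <= i < (absorbing c).+1) complete c f i = scale c)%N.
Proof.
move=> le_f; rewrite big_nat_recr //= {2}/complete ltnn.
rewrite (eq_big_nat _ _ (F2 := f)) ?subnKC // => i /andP[_ i_lt].
by rewrite /complete i_lt.
Qed.

Lemma ord_of_lrs u : ord_of (code_lrs u) = lrs_order u.
Proof. exact: code_nthE. Qed.

Lemma coef_of_lrs u : coef_of (code_lrs u) = code_vec (@lrs_coef u).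
Proof. exact: code_nthE. Qed.

Lemma init_of_lrs u :
  init_of (code_lrs u) = code_vec (fun i : 'I_(lrs_order u) => u i).
Proof. exact: code_nthE. Qed.

Lemma com_den_gt0 u : (0 < com_den (code_lrs u))%N.
Proof.
rewrite /com_den ord_of_lrs coef_of_lrs init_of_lrs !big_mkord muln_gt0.
by apply/andP; split; apply: prodn_gt0 => i;
  rewrite den_code_vec absz_gt0 denq_neq0.
Qed.

Lemma scale_gt0 u : (0 < scale (code_lrs u))%N.
Proof. by rewrite /scale -addnA ltn_addr ?com_den_gt0. Qed.

Lemma den_coef_dvd u (i : 'I_(lrs_order u)) :
  (den (code_vec (@lrs_coef u)) i %| com_den (code_lrs u))%N.
Proof.
rewrite /com_den ord_of_lrs coef_of_lrs; apply: dvdn_mulr.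
by rewrite big_mkord (bigD1 i) //= dvdn_mulr.
Qed.

Lemma den_init_dvd u (i : 'I_(lrs_order u)) :
  (den (code_vec (fun i : 'I_(lrs_order u) => u i)) i
     %| com_den (code_lrs u))%N.
Proof.
rewrite /com_den ord_of_lrs init_of_lrs; apply: dvdn_mull.
by rewrite big_mkord (bigD1 i) //= dvdn_mulr.
Qed.

(** States are written as sign bit plus twice the coordinate. The shift preserves the sign; in the
    recurrence row signs multiply, hence the index [s + t]. *)
Lemma trans0_pair c (s t : bool) i j :
  trans0 c (s + i.*2) (t + j.*2) =
    if j == 0%N then 0%N
    else if (i < ord_of c)%N
         then (if (j == i.+1) && (s == t) then com_den c else 0%N)
    else part (com_den c) (coef_of c) (s + t) j.-1.
Proof.
rewrite /trans0 !half_bit_double; case: eqP => // _.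
have -> : (t + j.*2 == (s + i.*2).+2)%N = (j == i.+1) && (s == t).
  by case: s t => [] []; lia.
case: ifP => // _; apply: part_odd.
by rewrite !oddD !odd_double !addbF.
Qed.

Lemma start0_pair c (s : bool) i :
  start0 c (s + i.*2) =
    if i == 0%N then 0%N else part (com_den c) (init_of c) s i.-1.
Proof.
rewrite /start0 !half_bit_double; case: eqP => // _; apply: part_odd.
by rewrite oddD odd_double addbF.
Qed.

(** The two parts of an initial term add up to its scaled absolute value, so the total is the last
    summand of [scale]. *)
Lemma sum_start0 u :
  (\sum_(0 <= k < absorbing (code_lrs u)) start0 (code_lrs u) k
     <= scale (code_lrs u))%N.
Proof.
set c := code_lrs u; rewrite /absorbing big_double big_nat_recl //=.
rewrite (_ : (_ + _)
  = \sum_(0 <= i < ord_of c) absn (com_den c) (init_of c) i)%N.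
  by rewrite /scale leq_addl.
rewrite -[RHS]add0n; congr addn; apply: eq_bigr => i _.
have := start0_pair c false i.+1; have := start0_pair c true i.+1.
by rewrite add0n add1n => -> ->; rewrite /= part_add.
Qed.

(** A column meets the shift in at most one entry [com_den], and the two recurrence rows together
    give one scaled absolute coefficient; both are covered by [scale]. *)
Lemma sum_trans0 u j :
  (\sum_(0 <= k < absorbing (code_lrs u)) trans0 (code_lrs u) k j
     <= scale (code_lrs u))%N.
Proof.
set c := code_lrs u; set d := ord_of c.
rewrite -(odd_double_half j); case: j./2 (odd j) => [|j'] t.
  by rewrite big1 // => k _; rewrite -(odd_double_half k) trans0_pair.
rewrite /absorbing big_double big_nat_recr //= -/d.
have pairE k : (trans0 c k.*2 (t + j'.+1.*2) + trans0 c k.*2.+1 (t + j'.+1.*2) =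
    if k < d then (if j' == k then com_den c else 0)
    else absn (com_den c) (coef_of c) j')%N.
  rewrite -[k.*2]/(false + k.*2)%N -[(_ + _).+1%N]/(true + k.*2)%N.
  rewrite !trans0_pair /= -/d eqSS.
  case: ifP => _; first by case: (j' == k); case: (t); rewrite ?addn0.
  case: (t); last by rewrite part_add.
  by rewrite addnC (@part_odd _ _ (1 + 1) 0) // part_add.
rewrite pairE ltnn (leq_trans _ (leq_addr _ _)) // leq_add //.
  rewrite (eq_big_nat _ _
    (F2 := fun k => if j' == k then com_den c else 0%N)); last first.
    by move=> k /andP[_ kd]; rewrite pairE kd.
  rewrite -big_mkcond (eq_bigl (pred1 j')); last by move=> k; rewrite /= eq_sym.
  by rewrite big_nat1_eq; case: ifP.
(* For [j' >= d], which includes the column of the absorbing state, the coefficient reads as 0. *)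
case: (ltnP j' d) => [j'd|dj'].
  by rewrite big_mkord (bigD1 (Ordinal j'd)) //= leq_addr.
by rewrite /absn coef_of_lrs num_code_vec_oversize // -ord_of_lrs.
Qed.


(** * The energy instance: its code, linearity and the Markov property *)

Definition chain_trans (c : nat) : 'M[rat]_((absorbing c).+1) :=
  \matrix_(i, j) ((complete c (trans0 c ^~ j) i)%:R / (scale c)%:R).

Definition chain_start (c : nat) : 'cV[rat]_((absorbing c).+1) :=
  \col_i ((complete c (start0 c) i)%:R / (scale c)%:R).

Definition chain_terms (c : nat) : seq (rat * 'X_{1.. (absorbing c).+1}) :=
  [:: (- (scale c)%:R, U_(inord 0)%MM); ((scale c)%:R, U_(inord 1)%MM);
      ((com_den c)%:R, U_(inord 2)%MM); (- (com_den c)%:R, U_(inord 3)%MM)].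

Definition chain_instance (c : nat) : energy_instance :=
  EnergyInstance (chain_trans c) (chain_start c) 0 (chain_terms c).

(** Order at least 1 provides coordinates 0 and 1, hence the four states that the weight reads. *)
Lemma absorbing_gt3 u : (3 < absorbing (code_lrs u))%N.
Proof. by rewrite /absorbing ord_of_lrs; have := lrs_order_gt0 u; lia. Qed.

Lemma code_chain_instance u :
  code_energy (chain_instance (code_lrs u)) = reduction (code_lrs u).
Proof.
have := scale_gt0 u; have := com_den_gt0 u; have := absorbing_gt3 u.
set c := code_lrs u => gt3 P_gt0 N_gt0.
have term_code r i : (i <= absorbing c)%N ->
    code_term (r, U_(inord i : 'I_(absorbing c).+1)%MM)
      = code_unit_term (code_rat r) (absorbing c).+1 i.
  move=> i_le; rewrite /code_term /code_unit_term.
  congr (CodeSeq.code [:: _; CodeSeq.code _]).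
  by apply: map_enum_ord => j; rewrite mnm1E -val_eqE /= inordK.
rewrite /code_energy /reduction.
congr (CodeSeq.code [:: _; CodeSeq.code _; CodeSeq.code _; _; _]).
- apply: map_enum_ord => i; congr CodeSeq.code.
  by apply: map_enum_ord => j; rewrite mxE code_frac_rat.
- apply: map_enum_ord => i; congr CodeSeq.code.
  apply: (@map_enum_ord _ 1 _
    (fun=> code_frac (complete c (start0 c) i) (scale c))).
  by move=> j; rewrite mxE code_frac_rat.
- by rewrite /= !term_code ?code_rat_oppn ?code_rat_nat //; lia.
Qed.

Lemma linear_chain_instance c : linear_weight (weight (chain_instance c)).
Proof.
rewrite /linear_weight /weight /= !big_cons big_nil addr0.
by do 3?[apply: rpredD]; apply: dhomogZ; rewrite dhomogX /= mdeg1.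
Qed.

Lemma sum_complete_ratio u f :
  (\sum_(0 <= k < absorbing (code_lrs u)) f k <= scale (code_lrs u))%N ->
  \sum_(i < (absorbing (code_lrs u)).+1)
     (complete (code_lrs u) f i)%:R / (scale (code_lrs u))%:R = 1 :> rat.
Proof.
move=> le_f; rewrite -mulr_suml -natr_sum -(big_mkord xpredT) sum_complete //.
by rewrite divff // pnatr_eq0 -lt0n scale_gt0.
Qed.

Lemma markov_chain_instance u :
  markov_chain (chain_trans (code_lrs u)) (chain_start (code_lrs u)).
Proof.
split=> [i j|i|j|].
- by rewrite mxE divr_ge0 ?ler0n.
- by rewrite mxE divr_ge0 ?ler0n.
- under eq_bigr => i _ do rewrite mxE.
  exact/sum_complete_ratio/sum_trans0.
- under eq_bigr => i _ do rewrite mxE.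
  exact/sum_complete_ratio/sum_start0.
Qed.

(** * Evolution of the chain *)

Definition state c k : nat -> rat :=
  fun i => (chain_trans c ^+ k *m chain_start c) (inord i) 0.

Definition coord c k i : rat := state c k i.*2 - state c k i.*2.+1.

Definition shifted (u : nat -> rat) (n : nat) : rat :=
  if n is n'.+1 then u n' else 0.

Lemma state0 c i : (i < absorbing c)%N ->
  state c 0 i = (start0 c i)%:R / (scale c)%:R.
Proof.
move=> i_lt; rewrite /state expr0 mul1mx mxE inordK ?ltnS 1?ltnW //.
by rewrite /complete i_lt.
Qed.

Lemma stateS c k i : (i < absorbing c)%N ->
  state c k.+1 i = \sum_(0 <= j < (absorbing c).+1)
    (trans0 c i j)%:R / (scale c)%:R * state c k j.
Proof.
move=> i_lt; rewrite /state exprS -mulmxE -mulmxA mxE big_mkord.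
apply: eq_bigr => j _.
by rewrite inord_val [in LHS]mxE inordK ?ltnS 1?ltnW // /complete i_lt.
Qed.

(** For [i] and [j] up to the order, this is [com_den] times the companion matrix of the shifted
    sequence. *)
Definition coord_trans (c i j : nat) : rat :=
  if j == 0%N then 0
  else if (i < ord_of c)%N then (if j == i.+1 then (com_den c)%:R else 0)
  else (part (com_den c) (coef_of c) 0 j.-1)%:R
       - (part (com_den c) (coef_of c) 1 j.-1)%:R.

(** The two columns of a pair act with opposite signs, so the differences of the pairs evolve among
    themselves. *)
Lemma trans0_sub c (t : bool) i j :
  (trans0 c i.*2 (t + j.*2))%:R - (trans0 c i.*2.+1 (t + j.*2))%:R
    = (-1) ^+ t * coord_trans c i j :> rat.
Proof.
have := trans0_pair c false t i j; rewrite add0n => ->.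
have := trans0_pair c true t i j; rewrite add1n => ->.
rewrite /coord_trans; case: eqP => _; first by rewrite subr0 mulr0.
case: ifP => _; first by case: eqP; case: t => _ /=; ring.
by case: t; rewrite /= ?addn0 ?addn1 ?(@part_odd _ _ 2 0) //; ring.
Qed.

(** The absorbing state has the index of the positive part of a coordinate [d + 1]; it feeds nothing
    back into the others. *)
Lemma coord_trans_last u i : (i <= lrs_order u)%N ->
  coord_trans (code_lrs u) i (lrs_order u).+1 = 0.
Proof.
rewrite /coord_trans ord_of_lrs coef_of_lrs /= eqSS; case: ltngtP => // _ _.
by rewrite /part /absn num_code_vec_oversize // !mul0n !if_same subrr.
Qed.

Lemma coordS u k i : (i <= lrs_order u)%N ->
  coord (code_lrs u) k.+1 i = \sum_(0 <= j < (lrs_order u).+1)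
    coord_trans (code_lrs u) i j / (scale (code_lrs u))%:R
      * coord (code_lrs u) k j.
Proof.
move=> i_le; have absE : absorbing (code_lrs u) = (lrs_order u).+1.*2.
  by rewrite /absorbing ord_of_lrs.
rewrite /coord !stateS ?absE; [|lia..].
rewrite -sumrB big_nat_recr //= -mulrBl -mulrBl.
have := trans0_sub (code_lrs u) false i (lrs_order u).+1.
rewrite add0n => ->; rewrite coord_trans_last // mulr0 !mul0r addr0.
rewrite big_double; apply: eq_bigr => j _ /=.
have := trans0_sub (code_lrs u) false i j; rewrite add0n mul1r => <-.
have := trans0_sub (code_lrs u) true i j; rewrite add1n mulN1r.
have := trans0_sub (code_lrs u) false i j; rewrite add0n mul1r => <-.
move: (scale _)%:R^-1 => N /(canRL (subrK _)) ->.
by ring.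
Qed.

(** Induction on [k] for all coordinates at once. The exponent is [k + 1] because the start vector
    already carries one factor [com_den / scale]. *)
Lemma coordE u k i : (i <= lrs_order u)%N ->
  coord (code_lrs u) k i =
    ((com_den (code_lrs u))%:R / (scale (code_lrs u))%:R) ^+ k.+1
      * shifted u (k + i).
Proof.
set c := code_lrs u; set d := lrs_order u; set rho := _ / _.
have absE : absorbing c = d.+1.*2 by rewrite /absorbing ord_of_lrs.
elim: k i => [|k IH] i i_le.
  rewrite /coord !state0 ?absE; [|lia..].
  have := start0_pair c false i; rewrite add0n => ->.
  have := start0_pair c true i; rewrite add1n => ->.
  case: i i_le => [|i] i_lt /=; first by rewrite subrr mulr0.
  rewrite -mulrBl init_of_lrs.
  have := part_sub (den_init_dvd (Ordinal i_lt)) => /= ->.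
  by rewrite /rho; ring.
rewrite coordS // -/c -/d.
rewrite (eq_big_nat _ _ (F2 := fun j =>
  coord_trans c i j / (scale c)%:R * (rho ^+ k.+1 * shifted u (k + j))));
  last first.
  by move=> j /andP[_ j_le]; rewrite IH.
case: (ltngtP i d) i_le => // [i_lt|->] _.
  rewrite (eq_bigr (fun j => if j == i.+1 then
    rho * (rho ^+ k.+1 * shifted u (k + j)) else 0)).
    by rewrite -big_mkcond big_nat1_eq /= ltnS i_lt addnS mulrA -exprS.
  move=> [|j] _; rewrite /coord_trans ?mul0r //= ord_of_lrs i_lt eqSS.
  by case: eqP => _; rewrite ?mul0r.
(* In row [d], column 0 drops out, and the value [u (k + d)] is expanded by the recurrence. *)
rewrite big_nat_recl //= {1}/coord_trans /= !mul0r add0r.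
rewrite lrs_rec mulr_sumr big_mkord; apply: eq_bigr => j _.
rewrite /coord_trans ord_of_lrs ltnn /= coef_of_lrs part_sub ?den_coef_dvd //.
rewrite addnS /= (exprS rho k.+1) {2}/rho; ring.
Qed.


(** * The telescoping energy and the reduction theorem *)

Lemma weight_chain_instance c (x : 'cV[rat]_(absorbing c).+1) :
  (weight (chain_instance c)).@[fun i => x i 0] =
    (com_den c)%:R * (x (inord 2) 0 - x (inord 3) 0)
    - (scale c)%:R * (x (inord 0) 0 - x (inord 1) 0).
Proof.
rewrite /weight /= !big_cons big_nil addr0 !mevalD !mevalZ !mevalXU /=.
by ring.
Qed.

Lemma sum_weight u n :
  \sum_(0 <= k < n.+1)
    (weight (chain_instance (code_lrs u))).@[fun i =>
       (chain_trans (code_lrs u) ^+ k *m chain_start (code_lrs u)) i 0]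
  = (scale (code_lrs u))%:R
    * ((com_den (code_lrs u))%:R / (scale (code_lrs u))%:R) ^+ n.+2 * u n.
Proof.
set c := code_lrs u; set rho := _ / _.
have N_neq0 : (scale c)%:R != 0 :> rat by rewrite pnatr_eq0 -lt0n scale_gt0.
(* The weight at time [k] is [z k.+1 - z k], since [scale * rho = com_den]; the sum starts from
   [z 0 = 0] because the shifted sequence begins with 0. *)
pose z k := (scale c)%:R * (rho ^+ k.+1 * shifted u k).
rewrite (eq_bigr (fun k => z k.+1 - z k)) => [|k _].
  by rewrite telescope_sumr // {2}/z /= mulr0 mulr0 subr0 /z mulrA.
rewrite weight_chain_instance -[_ - _ in X in X - _]/(coord c k 1).
rewrite -[_ - _ in X in _ - X]/(coord c k 0).
rewrite !coordE ?lrs_order_gt0 // addn1 addn0 -/c -/rho.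
have <- : (scale c)%:R * rho = (com_den c)%:R by rewrite mulrC divfK.
by rewrite /z (exprS rho k.+1); ring.
Qed.

Lemma yes_chain_instance u :
  yes (p := energy_satisfaction) (chain_instance (code_lrs u)) <->
  exists n, u n < 0.
Proof.
have rho_gt0 n : 0 < (scale (code_lrs u))%:R
    * ((com_den (code_lrs u))%:R / (scale (code_lrs u))%:R) ^+ n.+2 :> rat.
  by rewrite mulr_gt0 ?exprn_gt0 ?divr_gt0 // ltr0n ?scale_gt0 ?com_den_gt0.
by split=> -[n u_n]; exists n; move: u_n; rewrite /= sum_weight pmulr_rlt0.
Qed.

Theorem theorem30 :
  reducible positivity
    (restrict (P := energy_satisfaction) (fun I : energy_instance =>
       markov_chain (trans I) (start I) /\ linear_weight (weight I))).
Proof.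
set Q := restrict _; have [p pP] := computable_reduction.
(* The energy instance is satisfiable exactly when positivity fails, so the oracle's answer is
   negated. *)
have [flip flipP] : computable (fun e : env 1 => 1 - e.1)%N.
  exact: computable_sub (computable_const _ 1) (computable_fst _).
exists (Comp flip [:: Comp Query [:: p]]) => u.
have run y : oracle Q (reduction (code_lrs u)) y ->
    eval (oracle Q) (Comp flip [:: Comp Query [:: p]]) [:: code_lrs u]
      (1 - y)%N.
  move=> Oy; apply: (eval_Comp _ (flipP _ (y, tt))).
  apply: evals_cons; last exact: evals_nil.
  apply: (@eval_Comp _ _ _ _ [:: reduction (code_lrs u)]);
    last exact: eval_Query.
  by apply: evals_cons; [exact: (pP _ (code_lrs u, tt)) | exact: evals_nil].
(* The oracle answers only on codes of restricted instances, so the query is packaged with its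
   Markov and linearity proofs. *)
pose I : instance Q := exist _ (chain_instance (code_lrs u))
  (conj (markov_chain_instance u) (linear_chain_instance _)).
have IE : reduction (code_lrs u) = code I := esym (code_chain_instance u).
split=> [u_ge0|u_neg].
  apply: (run 0%N); exists I => //; right; split=> // /yes_chain_instance[n].
  by rewrite ltNge u_ge0.
apply: (run 1%N); exists I => //; left; split=> //; apply/yes_chain_instance.
(* A negative term is extracted classically from the failure of positivity. *)
have [n /negP u_n] := not_all_ex_not _ _ u_neg.
by exists n; rewrite ltNge.
Qed.
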